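(* Let $\bar x\in\mathcal F$ be a feasible point of the constraint system $x\in C$, $G(x)\in K$, and assume that Robinson's constraint qualification is satisfied at $\bar x$. Further, assume that $C=X$ and that $G\colon X\to Y$ and $G'\colon X\to\mathbb L(X,Y)$ are completely continuous. Then $\bar x$ is w-AKKT regular.
   Context: Setting: $X$ and $Y$ are real Banach spaces, $G\colon X\to Y$ is continuously Fréchet differentiable, $C\subset X$ and $K\subset Y$ are nonempty, closed, convex sets, and $\mathcal F:=\{x\in C\mid G(x)\in K\}$. $\mathbb L(X,Y)$ is the Banach space of bounded linear operators from $X$ to $Y$ with the operator norm. A mapping $T$ between Banach spaces is completely continuous if $x^k\rightharpoonup x$ (weakly) implies $T(x^k)\to T(x)$ (strongly). For a closed convex set $S$ and $x\in S$, the radial cone is $\mathcal R_S(x):=\{\alpha(z-x)\mid\alpha\ge0,\ z\in S\}$. Robinson's constraint qualification (RCQ) holds at $\bar x\in\mathcal F$ if $Y=G'(\bar x)\,\mathcal R_C(\bar x)-\mathcal R_K(G(\bar x))$. $\mathcal N_C(x):=\{v\in X^*\mid\langle v,z-x\rangle_X\le0\ \forall z\in C\}$ for $x\in C$ and $\mathcal N_C(x):=\varnothing$ for $x\notin C$. For $x\in X$ and $r\ge0$ let $$\mathcal M(x,r):=\{G'(x)^*\lambda+\mu\in X^*\mid \lambda\in Y^*,\ \mu\in\mathcal N_C(x),\ \langle\lambda,y-G(x)\rangle_Y\le r\ \forall y\in K\}.$$ A point $\bar x\in\mathcal F$ is w-AKKT regular if every $\bar v\in X^*$ for which there exist sequences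 $\{x^k\}\subset X$, $\{r^k\}\subset[0,+\infty)$, $\{v^k\}\subset X^*$ with $x^k\rightharpoonup\bar x$ (weakly), $r^k\to0$, $v^k\rightharpoonup^*\bar v$ (weak* ) and $v^k\in\mathcal M(x^k,r^k)$ for all $k$ belongs to $\mathcal M(\bar x,0)$. *)

(* Defs.v *)
From HB Require Import structures.
From mathcomp Require Import all_boot all_order all_algebra.
From mathcomp Require Import all_classical all_reals all_analysis.

Set Implicit Arguments.
Unset Strict Implicit.
Unset Printing Implicit Defensive.

Import Order.TTheory GRing.Theory Num.Theory.
Import numFieldNormedType.Exports.

Local Open Scope classical_set_scope.
Local Open Scope ring_scope.

Section BoundedOperators.
Context {R : realType} {X Y : normedModType R}.

(* A linear map between normed modules is bounded iff it is continuous
   ([linear_bounded_continuous]). *)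
Definition bounded_op_pred : {pred X -> Y} :=
  fun f => `[< linear f /\ continuous f >].

Lemma bounded_opP (f : X -> Y) :
  reflect (linear f /\ continuous f) (f \in bounded_op_pred).
Proof. exact: asboolP. Qed.

Record bounded_op := BoundedOp {
  bounded_op_fun :> X -> Y;
  _ : bounded_op_fun \in bounded_op_pred }.

HB.instance Definition _ := [isSub for bounded_op_fun].
HB.instance Definition _ := [Choice of bounded_op by <:].

Lemma bounded_op_submod_closed : subsemimod_closed bounded_op_pred.
Proof.
split; first split.
- apply/bounded_opP; split; last exact: cst_continuous.
  by move=> a x y /=; rewrite scaler0 addr0.
- move=> f g /bounded_opP[lf cf] /bounded_opP[lg cg]; apply/bounded_opP; split.
    by move=> a x y; rewrite !addrfctE lf lg scalerDr addrACA.
  by move=> x; exact: (cvgD (cf x) (cg x)).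
- move=> a f /bounded_opP[lf cf]; apply/bounded_opP; split.
    by move=> b x y; rewrite !scalrfctE lf scalerDr !scalerA mulrC.
  by move=> x; exact: (cvgZl_tmp (cf x)).
Qed.

HB.instance Definition _ :=
  GRing.SubChoice_isSubLmodule.Build R (X -> Y) bounded_op_pred bounded_op
    bounded_op_submod_closed.

Lemma bounded_op_linear (f : bounded_op) : linear f.
Proof. by have /bounded_opP[] := valP f. Qed.

Lemma bounded_op_continuous (f : bounded_op) : continuous f.
Proof. by have /bounded_opP[] := valP f. Qed.

HB.instance Definition _ (f : bounded_op) :=
  GRing.isLinear.Build R X Y *:%R (bounded_op_fun f) (bounded_op_linear f).

End BoundedOperators.
Arguments bounded_op_pred {R} X Y.
Arguments bounded_op {R} X Y.
Notation "''L' ( X , Y )" := (bounded_op X Y)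
  (at level 8, format "''L' ( X ,  Y )") : type_scope.

Section OperatorNorm.
Context {R : realType} {X Y : normedModType R}.
Implicit Types f g : 'L(X, Y).

Lemma bounded_op0E x : (0 : 'L(X, Y)) x = 0. Proof. by []. Qed.
Lemma bounded_opDE f g x : (f + g) x = f x + g x. Proof. by []. Qed.
Lemma bounded_opZE a f x : (a *: f) x = a *: f x. Proof. by []. Qed.

Definition op_norm f : R := sup [set `|f x| | x in [set x | `|x| <= 1]].

Lemma op_norm_has_sup f : has_sup [set `|f x| | x in [set x | `|x| <= 1]].
Proof.
split; first by exists `|f 0|, 0 => //=; rewrite normr0.
have /linear_bounded_continuous/bounded_funP/(_ 1)[M fM] :=
  @bounded_op_continuous _ _ _ f.
by exists M => _ [x /= x1 <-]; exact: fM.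
Qed.

Lemma le_op_norm1 f x : `|x| <= 1 -> `|f x| <= op_norm f.
Proof. by move=> x1; apply: sup_ubound; [case: (op_norm_has_sup f)|exists x]. Qed.

Lemma op_norm_le f M : (forall x, `|x| <= 1 -> `|f x| <= M) -> op_norm f <= M.
Proof.
move=> fM; apply: ge_sup; first by case: (op_norm_has_sup f).
by move=> _ [x /= /fM + <-].
Qed.

Lemma op_norm_ge0 f : 0 <= op_norm f.
Proof. by apply: le_trans (@le_op_norm1 f 0 _); rewrite ?normr0. Qed.

Lemma le_op_norm f x : `|f x| <= op_norm f * `|x|.
Proof.
have [->|x0] := eqVneq x 0; first by rewrite linear0 !normr0 mulr0.
have nx : 0 < `|x| by rewrite normr_gt0.
rewrite -ler_pdivrMr// mulrC -[X in X * _]ger0_norm ?invr_ge0// -normrZ -linearZ.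
by apply: le_op_norm1; rewrite normrZ ger0_norm ?invr_ge0// mulVf// gt_eqF.
Qed.

Lemma op_normD f g : op_norm (f + g) <= op_norm f + op_norm g.
Proof.
apply: op_norm_le => x x1; rewrite bounded_opDE (le_trans (ler_normD _ _))//.
by rewrite lerD// le_op_norm1.
Qed.

Lemma op_normZ a f : op_norm (a *: f) = `|a| * op_norm f.
Proof.
have le b h : op_norm (b *: h) <= `|b| * op_norm h.
  apply: op_norm_le => x x1; rewrite bounded_opZE normrZ.
  by rewrite ler_wpM2l// le_op_norm1.
apply/eqP; rewrite eq_le le/=.
have [->|a0] := eqVneq a 0; first by rewrite normr0 mul0r op_norm_ge0.
have := le a^-1 (a *: f); rewrite scalerA mulVf// scale1r normrV ?unitfE//.
by rewrite mulrC ler_pdivlMr ?normr_gt0// mulrC.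
Qed.

Lemma op_norm0_eq0 f : op_norm f = 0 -> f = 0.
Proof.
move=> f0; apply/val_inj/funext => x; apply/normr0_eq0/eqP.
by rewrite eq_le normr_ge0 andbT (le_trans (le_op_norm f x))// f0 mul0r.
Qed.

HB.instance Definition _ := @Lmodule_isNormed.Build R 'L(X, Y)
  op_norm op_normD op_normZ op_norm0_eq0.

Lemma op_normE f : `|f| = op_norm f. Proof. by []. Qed.

End OperatorNorm.

Definition dual {R : realType} (X : normedModType R) := 'L(X, R^o).

Section Adjoint.
Context {R : realType} {X Y : normedModType R}.

Lemma adjoint_subproof (A : 'L(X, Y)) (lam : dual Y) :
  (lam \o A : X -> R^o) \in bounded_op_pred X R^o.
Proof.
apply/bounded_opP; split=> [a x y /=|x]; first by rewrite !linearP.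
exact: continuous_comp (@bounded_op_continuous _ _ _ A x)
                       (@bounded_op_continuous _ _ _ lam (A x)).
Qed.

Definition adjoint (A : 'L(X, Y)) (lam : dual Y) : dual X :=
  BoundedOp (adjoint_subproof A lam).

End Adjoint.

Section Derivative.
Context {R : realType} {X Y : normedModType R}.
Implicit Type G : X -> Y.

(* ['d G x] as an element of L(X, Y), with the default value 0 when G is not
   differentiable at x and ['d G x] is not continuous. *)
Definition frechet G (x : X) : 'L(X, Y) := insubd 0 ('d G x : X -> Y).

Lemma frechetE G x : differentiable G x -> frechet G x = 'd G x :> (X -> Y).
Proof.
move=> dGx; rewrite /frechet -[LHS]/(val _) val_insubd.
case: ifPn => // /bounded_opP[]; split; first exact: linearP.
exact: diff_continuous.
Qed.

Definition continuously_differentiable G :=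
  (forall x, differentiable G x) /\ continuous (frechet G).

End Derivative.

Section WeakConvergence.
Context {R : realType}.

Definition weakly_cvg (X : normedModType R) (x : nat -> X) (l : X) :=
  forall f : dual X, f (x k) @[k --> \oo] --> f l.

Definition weakly_star_cvg (X : normedModType R) (v : nat -> dual X)
    (l : dual X) :=
  forall x : X, v k x @[k --> \oo] --> l x.

Definition completely_continuous (X Y : normedModType R) (T : X -> Y) :=
  forall (x : nat -> X) (l : X),
    weakly_cvg x l -> T (x k) @[k --> \oo] --> T l.

End WeakConvergence.

Section ConstraintSystem.
Context {R : realType} {X Y : normedModType R}.
Variables (G : X -> Y) (C : set X) (K : set Y).

Definition feasible : set X := [set x | C x /\ K (G x)].

Definition radial_cone (Z : normedModType R) (S : set Z) (x : Z) : set Z :=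
  [set alpha *: (z - x) | alpha in [set a : R | 0 <= a] & z in S].

Definition robinson_cq (x : X) :=
  [set frechet G x d - w | d in radial_cone C x & w in radial_cone K (G x)]
  = [set: Y].

Definition normal_cone (x : X) : set (dual X) :=
  [set v : dual X | C x /\ forall z, C z -> v (z - x) <= 0].

Definition approx_multiplier_set (x : X) (r : R) : set (dual X) :=
  [set v : dual X | exists (lam : dual Y) (mu : dual X),
    [/\ normal_cone x mu,
        forall y, K y -> lam (y - G x) <= r &
        v = adjoint (frechet G x) lam + mu]].

Definition w_AKKT_regular (xbar : X) :=
  forall vbar : dual X,
    (exists (x : nat -> X) (r : nat -> R) (v : nat -> dual X),
      [/\ weakly_cvg x xbar,
          (forall k, 0 <= r k) /\ r k @[k --> \oo] --> 0,
          weakly_star_cvg v vbar &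
          forall k, approx_multiplier_set (x k) (r k) (v k)]) ->
    approx_multiplier_set xbar 0 vbar.

End ConstraintSystem.

(* Main.v *)
(** Since [C] is the whole space, the normal cone is trivial and
    [v_k = l_k o G'(x_k)] for multipliers [l_k]. It suffices to bound the [l_k]:
    by complete continuity, a weak* limit of the [l_k] along an ultrafilter is
    then a multiplier for [vbar].  With
    [e_k = |G x_k - G xbar| + |G'(x_k) - G'(xbar)| -> 0], decomposing [- y]
    according to Robinson's condition gives, for each [y] separately,
    [l_k y <= M_y (1 + e_k |l_k|)].  Hence the functionals
    [l_k / (1 + e_k |l_k|)] are pointwise bounded, so uniformly bounded by
    Banach-Steinhaus: [|l_k| <= M (1 + e_k |l_k|)], and the last term is
    eventually absorbed.  This pointwise use of Robinson's condition avoids the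
    generalized open mapping theorem. *)

Require Import Defs.
From HB Require Import structures.
From mathcomp Require Import all_boot all_order all_algebra.
From mathcomp Require Import all_classical all_reals all_analysis.
From mathcomp Require Import lra.

Import Order.TTheory GRing.Theory Num.Theory.
Import numFieldNormedType.Exports.

Local Open Scope classical_set_scope.
Local Open Scope ring_scope.

(** Banach-Steinhaus at radius 1: the uniform bound it gives on the unit ball bounds each operator
    norm, a supremum over that ball. *)
Lemma bounded_op_uniform_bounded (R : realType) (X : completeNormedModType R)
    (Y : normedModType R) (I : Type) (f : I -> 'L(X, Y)) :
  (forall x, exists M, forall i, `|f i x| <= M) ->
  exists M, forall i, `|f i| <= M.
Proof.
move=> fM.
have bl (g : X -> Y) : range (fun i => f i : X -> Y) g ->
    bounded_fun_norm g /\ linear g.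
  move=> [i _ <-]; split; last exact: linearP.
  move=> r; exists (`|f i| * r) => x xr.
  by rewrite (le_trans (le_op_norm _ _))// ler_wpM2l ?op_norm_ge0.
have pb : pointwise_bounded (range (fun i => f i : X -> Y)).
  by move=> x; have [M Mx] := fM x; exists M => _ [i _ <-].
have [M fM1] := Banach_Steinhauss bl pb 1.
by exists M => i; apply: op_norm_le => x; apply: fM1; exists i.
Qed.

Lemma cvg_seq_norm_le {R : realType} {V : normedModType R} {u : nat -> V}
    {a : V} :
  u k @[k --> \oo] --> a -> exists2 M, 0 < M & forall k, `|u k| <= M.
Proof.
move=> /cvgP /cvg_seq_bounded /pinfty_ex_gt0[M M_gt0 uM].
by exists M => // k; exact: uM.
Qed.

Lemma dual_perturbed_bounded (R : realType) (Y : completeNormedModType R)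
    (l : nat -> dual Y) (e : nat -> R) :
  (forall k, 0 <= e k) -> e k @[k --> \oo] --> 0 ->
  (forall y, exists M, forall k, l k y <= M * (1 + e k * `|l k|)) ->
  exists M, \forall k \near \oo, `|l k| <= M.
Proof.
move=> e0 ecvg lM; pose s k := 1 + e k * `|l k|.
have s_gt0 k : 0 < s k by rewrite ltr_pwDl// mulr_ge0.
have [|M sM] := @bounded_op_uniform_bounded R Y R^o nat
    (fun k => (s k)^-1 *: l k).
  (* The hypothesis is one-sided; using it at [y] and at [- y] bounds the absolute value. *)
  move=> y; have [M1 yM] := lM y; have [M2 yN] := lM (- y).
  exists (Num.max M1 M2) => k; rewrite bounded_opZE.
  rewrite [_ *: _]mulrC ler_norml ler_pdivlMr// ler_pdivrMr//.
  rewrite mulNr lerNl -linearN; apply/andP; split.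
    apply: le_trans (yN k) _.
    by rewrite ler_wpM2r ?(ltW (s_gt0 k))// le_max lexx orbT.
  by apply: le_trans (yM k) _; rewrite ler_wpM2r ?(ltW (s_gt0 k))// le_max lexx.
have lsM k : `|l k| <= M * s k.
  have := sM k; rewrite normrZ ger0_norm ?invr_ge0 ?(ltW (s_gt0 k))//.
  by rewrite ler_pdivrMl// mulrC.
have M0 : 0 <= M by apply: le_trans (sM 0).
(* Once [M * e k <= 1/2], the bound [lsM] reads [|l k| <= M + |l k| / 2]. *)
exists (2 * M).
have Me : M * e k @[k --> \oo] --> 0.
  by rewrite -[0 in X in _ --> X](mulr0 M); exact: cvgMr.
have Mek2 : \forall k \near \oo, M * e k <= 2^-1.
  by apply: (cvgr_le _ Me); rewrite invr_gt0.
apply: filterS Mek2 => k Mek.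
have := lsM k; rewrite /s mulrDr mulr1 mulrA => lek.
have : M * e k * `|l k| <= 2^-1 * `|l k| by rewrite ler_wpM2r.
lra.
Qed.

(** If a set [A] of a finer proper filter had a preimage outside [U], the complement of that
    preimage would be in [U], so the filter would contain both [A] and its complement. *)
Lemma fmap_ultra {T T' : Type} (f : T -> T') {U : set_system T} :
  UltraFilter U -> UltraFilter (f @ U).
Proof.
move=> UU; apply: Build_UltraFilter => F FF UF.
apply/seteqP; split=> [A FA|]; last exact: UF.
have [//|UA] := in_ultra_setVsetC (f @^-1` A) UU.
have [x []//] : (A `&` ~` A) !=set0.
apply: (@filter_ex _ F); apply: filterI => //; exact: UF.
Qed.

(** A form of Banach-Alaoglu: for each [y] the values [l t y] eventually lie in a compact segment,
    so they converge along [U]; linearity and the bound [M * |y|] pass to the limit. *)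
Lemma dual_ultra_cvg (R : realType) (Y : normedModType R) (T : Type)
    (U : set_system T) (UU : UltraFilter U) (l : T -> dual Y) (M : R) :
  (\forall t \near U, `|l t| <= M) ->
  exists l0 : dual Y, forall y, l t y @[t --> U] --> l0 y.
Proof.
move=> lM.
have lMy y : \forall t \near U, `|l t y| <= M * `|y|.
  apply: filterS lM => t lt; apply: le_trans (le_op_norm _ _) _.
  by rewrite ler_wpM2r.
have lcvg y : exists a : R^o, l t y @[t --> U] --> a.
  have := @segment_compact R (- (M * `|y|)) (M * `|y|).
  rewrite compact_ultra => segU.
  have [|a [_ la]] := segU _ (fmap_ultra (fun t => l t y) UU); last by exists a.
  by apply: filterS (lMy y) => t /=; rewrite ler_norml in_itv.
have [l0 l0P] := choice lcvg.
have lin : linear (l0 : Y -> R^o).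
  move=> a x y; apply: (cvg_unique _ (l0P _)) => //.
  rewrite (_ : (fun t => _) = (fun t => a *: (l t x : R^o) + l t y)).
    by apply: cvgD; [exact: cvgZl_tmp|].
  by apply/funext => t; rewrite linearP.
have l0M y : `|l0 y| <= M * `|y|.
  exact: cvgr_to_le (cvg_norm (l0P y)) (lMy y).
pose L : {linear Y -> R^o} := HB.pack l0 (GRing.isLinear.Build _ _ _ _ _ lin).
have cont : continuous L.
  apply/linear_bounded_continuous/bounded_funP => r.
  (* The sign of [M] is not known here, and monotonicity in [|x|] needs a nonnegative factor. *)
  exists (`|M| * r) => x xr; apply: le_trans (l0M x) _.
  apply: (@le_trans _ _ (`|M| * `|x|)); first by rewrite ler_wpM2r// ler_norm.
  by rewrite ler_wpM2l.
have l0b : l0 \in bounded_op_pred Y R^o by apply/bounded_opP.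
by exists (BoundedOp l0b).
Qed.

(** Testing at [z + x] and [- z + x] gives both signs of [v z]. *)
Lemma normal_cone_setT (R : realType) (X : normedModType R) (x : X) :
  normal_cone [set: X] x = [set 0].
Proof.
apply/seteqP; split=> [v [_ vle]|_ ->]; last by split.
apply/val_inj/funext => z /=; apply/eqP; rewrite eq_le.
have /= := vle (z + x) I; rewrite addrK => ->/=.
by have /= := vle (- z + x) I; rewrite addrK linearN oppr_le0.
Qed.

Theorem theorem5p3 (R : realType) (X Y : completeNormedModType R)
    (G : X -> Y) (C : set X) (K : set Y) (xbar : X)
    (G_C1 : continuously_differentiable G)
    (C_neq0 : C !=set0) (C_closed : closed C)
    (C_convex : convex_set (C : set (convex_lmodType X)))
    (K_neq0 : K !=set0) (K_closed : closed K)
    (K_convex : convex_set (K : set (convex_lmodType Y)))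
    (xbar_feasible : feasible G C K xbar)
    (rcq : robinson_cq G C K xbar)
    (C_setT : C = [set: X])
    (G_cc : completely_continuous G)
    (dG_cc : completely_continuous (frechet G)) :
  w_AKKT_regular G C K xbar.
Proof.
move=> vbar [x [r [v [xcvg [r_ge0 rcvg] vcvg vM]]]].
have {vM}/choice[l lP] : forall k, exists lam : dual Y,
    (forall y, K y -> lam (y - G (x k)) <= r k) /\
    v k = adjoint (frechet G (x k)) lam.
  move=> k; have [lam [mu []]] := vM k.
  by rewrite C_setT normal_cone_setT => -> lamr ->; exists lam; rewrite addr0.
have lr k y : K y -> l k (y - G (x k)) <= r k by case: (lP k) => /(_ y).
have vE k d : v k d = l k (frechet G (x k) d) by have [_ ->] := lP k.
pose e k : R := `|G (x k) - G xbar| + `|frechet G (x k) - frechet G xbar|.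
have e_ge0 k : 0 <= e k by rewrite addr_ge0.
have ecvg : e k @[k --> \oo] --> 0.
  rewrite -(addr0 0); apply: cvgD; apply/norm_cvg0P/subr_cvg0.
    exact: G_cc.
  exact: dG_cc.
have lG k : `|l k (G (x k) - G xbar)| <= e k * `|l k|.
  apply: le_trans (le_op_norm _ _) _.
  by rewrite mulrC ler_wpM2r ?op_norm_ge0// /e lerDl.
have ldG k d : `|v k d - l k (frechet G xbar d)| <= e k * `|l k| * `|d|.
  rewrite vE -linearB; apply: le_trans (le_op_norm _ _) _.
  rewrite [leRHS]mulrAC [leRHS]mulrC ler_wpM2l ?op_norm_ge0//.
  have := le_op_norm (frechet G (x k) - frechet G xbar) d.
  move=> /le_trans; apply.
  by rewrite ler_wpM2r// /e lerDr.
have [M lM] : exists M, \forall k \near \oo, `|l k| <= M.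
  apply: (@dual_perturbed_bounded _ _ _ e) => // y.
  have : [set: Y] (- y) by [].
  rewrite -rcq => -[_ [a a_ge0 [d' _ <-]]] [_ [b b_ge0 [z Kz <-]]].
  (* Now [- y = G'(xbar) d - b (z - G xbar)], so the sign makes [l k (z - G xbar)] enter [l k y]
     with the factor [b >= 0], where [lr] bounds it from above. *)
  set d := a *: _ => yE.
  have [Mv Mv_gt0 vMv] : exists2 Mv, 0 < Mv & forall k, `|v k d| <= Mv.
    exact: cvg_seq_norm_le (vcvg d).
  have [Mr Mr_gt0 rMr] : exists2 Mr, 0 < Mr & forall k, `|r k| <= Mr.
    exact: cvg_seq_norm_le rcvg.
  exists (Mv + `|d| + b * (Mr + 1)) => k.
  have -> : l k y = (v k d - l k (frechet G xbar d)) - v k d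
      + b * (l k (z - G (x k)) + l k (G (x k) - G xbar)).
    have lz : l k (z - G xbar) = l k (z - G (x k)) + l k (G (x k) - G xbar).
      by rewrite -linearD addrA subrK.
    have lb : l k (b *: (z - G xbar)) = b * l k (z - G xbar) by exact: linearZ.
    by rewrite -lz -lb -[y]opprK -yE linearN linearB/=; lra.
  have s_ge1 : 1 <= 1 + e k * `|l k| by rewrite lerDl mulr_ge0.
  have v_le : - v k d <= Mv * (1 + e k * `|l k|).
    rewrite (le_trans (ler_norm _))// normrN (le_trans (vMv k))//.
    by rewrite ler_peMr// ltW.
  have d_le : v k d - l k (frechet G xbar d) <= `|d| * (1 + e k * `|l k|).
    rewrite (le_trans (ler_norm _))// (le_trans (ldG k d))// mulrC.
    by rewrite ler_wpM2l// lerDr.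
  have z_le : l k (z - G (x k)) <= Mr * (1 + e k * `|l k|).
    rewrite (le_trans (lr k z Kz))// (le_trans (ler_norm _))//.
    by rewrite (le_trans (rMr k))// ler_peMr// ltW.
  have G_le : l k (G (x k) - G xbar) <= 1 + e k * `|l k|.
    by rewrite (le_trans (ler_norm _))// (le_trans (lG k))// lerDr.
  have := ler_wpM2l b_ge0 (lerD z_le G_le).
  set s := 1 + e k * `|l k| in v_le d_le *.
  rewrite -[X in _ <= b * (_ + X)]mul1r -mulrDl mulrA !mulrDl => bz_le.
  lra.
(* [U] refines [\oo], so every sequential limit and eventual bound carries over to [U]. *)
have [U [UU Uoo]] := @ultraFilterLemma _ \oo _.
have [l0 l0P] := @dual_ultra_cvg _ _ _ U UU l M (Uoo _ lM).
exists l0, 0; split.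
- by rewrite C_setT normal_cone_setT.
- move=> y Ky.
  have rU : r k @[k --> U] --> 0 by apply: cvg_trans rcvg => A /Uoo.
  have eU : e k * M @[k --> U] --> 0.
    rewrite -[0 in X in _ --> X](mul0r M); apply: cvgMl.
    by apply: cvg_trans ecvg => A /Uoo.
  rewrite -[0](addr0 0).
  apply: ler_cvg_to (l0P _) (cvgD rU eU) _.
  apply: filterS (Uoo _ lM) => k lkM.
  have -> : y - G xbar = (y - G (x k)) + (G (x k) - G xbar).
    by rewrite addrA subrK.
  rewrite linearD lerD ?lr// (le_trans (ler_norm _))// (le_trans (lG k))//.
  by rewrite ler_wpM2l.
- rewrite addr0; apply/val_inj/funext => d /=.
  have vU : v k d @[k --> U] --> vbar d by apply: cvg_trans (vcvg d) => A /Uoo.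
  have eU : e k * (M * `|d|) @[k --> U] --> 0.
    rewrite -[0 in X in _ --> X](mul0r (M * `|d|)); apply: cvgMl.
    by apply: cvg_trans ecvg => A /Uoo.
  (* The norm of the difference is the limit along [U] of the left side of [ldG], whose right side
     is eventually at most [e k * (M * |d|)]. *)
  apply/eqP; rewrite -subr_eq0 -normr_le0.
  apply: ler_cvg_to (cvg_norm (cvgB vU (l0P _))) eU _.
  apply: filterS (Uoo _ lM) => k lkM.
  by rewrite (le_trans (ldG k d))// -mulrA ler_wpM2l// ler_wpM2r.
Qed.
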